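(* The structure $\mathfrak B_1$ can be reconstructed (i.e. is definable) in terms of the Grassmannian of regular secunda and hyperplanes $\mathfrak G_{n-2}=\langle\mathscr R_{n-2},\mathscr R_{n-1},\subset\rangle$.
   Context: Setting. $\mathfrak F$ is a perfect field of characteristic $2$, $\mathbb V$ is a vector space over $\mathfrak F$ of finite dimension $n\ge 3$, and $\mathfrak P$ is the projective space of $\mathbb V$ (points are $\langle u\rangle$ with $u\in\mathbb V$ nonzero). Lines of $\mathfrak P$ have at least $6$ points. $\xi$ is a nondegenerate symmetric bilinear form on $\mathbb V$ which is not alternating, and $\langle u\rangle\perp\langle v\rangle$ means $\xi(u,v)=0$. The set $\mathbf H$ of selfconjugate points ($p\perp p$) is then a hyperplane of $\mathfrak P$, and its pole is a point $\mathbf b$ (so $\mathbf b^\perp=\mathbf H$); $\mathbf b$ may or may not lie on $\mathbf H$. For a subspace $U$ of $\mathfrak P$, $\dim(U)$ is the vector dimension (points have dimension $1$, lines $2$), $U^\perp=\{p: p\perp q\text{ for all }q\in U\}$, and $U$ is regular if $U\cap U^\perp=\emptyset$. $\mathscr R_k$ is the set of regular $k$-dimensional subspaces. Regular points are exactly the points not on $\mathbf H$. Structures. $\mathfrak B_1$ is the point-line structure with points the regular points different from $\mathbf b$, lines the regular lines not contained in $\mathbf H$, and natural incidence. $\mathfrak G_{n-2}$ is the point-line structure whose points are the members of $\mathscr R_{n-2}$, whose lines are the members of $\mathscr R_{n-1}$, with inclusion as incidence. Definability. Let $M,N$ be structures whose elements are points or subspaces of $\mathfrak P$. $N$ is definable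 in terms of $M$ if it can be described using only the primitive notions of $M$: the elements of $N$ can be represented by tuples of elements of $M$ ranging over sets given by parameter-free first-order formulas in the language of $M$, modulo equivalence relations given by such formulas, in such a way that all the primitive relations of $N$, and the natural inclusion relations between elements of $N$ and elements of $M$ (as subspaces of $\mathfrak P$), are given by such formulas as well.
   Formalization: Definability of the inclusion relations between elements of B_1 and elements of G_{n-2} is claimed only for members of R_{n-1} and those members of R_{n-2} that lie in some regular hyperplane; for the other regular secunda it fails when n ≥ 4. *)

(* Defs.v *)
From HB Require Import structures.
From mathcomp Require Import all_boot all_order all_algebra.

Set Implicit Arguments.
Unset Strict Implicit.
Unset Printing Implicit Defensive.

Import GRing.Theory.
Local Open Scope ring_scope.

Definition perfect_field (F : fieldType) : Prop :=
  forall p : nat, p \in [pchar F] -> forall x : F, exists y : F, y ^+ p = x.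

(* Subspaces of the projective space of V are the vector subspaces of V; its
   points are the subspaces of vector dimension 1, its lines those of vector
   dimension 2, and the empty subspace is 0. *)
Section MetricProjectiveGeometry.

Variables (F : fieldType) (V : vectType F).

Definition lines_have_6_points : Prop :=
  forall L : {vspace V}, \dim L = 2%N ->
    exists s : seq {vspace V},
      [/\ uniq s, (6 <= size s)%N &
          {in s, forall p, \dim p = 1%N /\ (p <= L)%VS}].

Variable xi : {symmetric V}.

Definition alternating : Prop := forall u : V, xi u u = 0.

Definition perp (p q : {vspace V}) : bool := (p <= orthov xi q)%VS.

Definition selfconjugate (p : {vspace V}) : Prop := \dim p = 1%N /\ perp p p.

Definition regular (U : {vspace V}) : Prop := (U :&: orthov xi U = 0)%VS.

Definition regular_subspaces (k : nat) (U : {vspace V}) : Prop :=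
  \dim U = k /\ regular U.

(* [is_pole b] says that b is a point and that b^perp is the hyperplane H of
   all selfconjugate points; nondegeneracy makes such a b unique. *)
Definition is_pole (b : {vspace V}) : Prop :=
  \dim b = 1%N /\
  forall p : {vspace V}, \dim p = 1%N -> (perp p b <-> selfconjugate p).

Definition contained_in_H (U : {vspace V}) : Prop :=
  forall p : {vspace V}, \dim p = 1%N -> (p <= U)%VS -> selfconjugate p.

End MetricProjectiveGeometry.

(* Point-line structures whose points and lines are subspaces, a point being
   incident with a line when it is included in it. *)
Record structure (F : fieldType) (V : vectType F) := Structure {
  points : {vspace V} -> Prop;
  lines : {vspace V} -> Prop
}.

Definition structB1 (F : fieldType) (V : vectType F) (xi : {symmetric V}) :=
  Structure
    (fun p => regular_subspaces xi 1 p /\ ~ is_pole xi p)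
    (fun L => regular_subspaces xi 2 L /\ ~ contained_in_H xi L).

Definition structG (F : fieldType) (V : vectType F) (xi : {symmetric V})
    (k : nat) :=
  Structure (regular_subspaces xi k) (regular_subspaces xi k.+1).

(* First-order formulas, with equality, of the language of point-line
   structures. The free variables are taken in X, and [FEx] binds the variable
   [None] of a formula over [option X]. *)
Inductive formula (X : Type) : Type :=
  | FPoint of X
  | FLine of X
  | FInc of X & X
  | FEq of X & X
  | FNot of formula X
  | FAnd of formula X & formula X
  | FEx of formula (option X).

Section Definability.

Variables (F : fieldType) (V : vectType F).
Implicit Types (M N : structure V) (U : {vspace V}).

Definition element M U : Prop := points M U \/ lines M U.

Definition scons (X T : Type) (t : T) (v : X -> T) (o : option X) : T :=
  if o is Some x then v x else t.

Definition sjoin (X Y T : Type) (v : X -> T) (w : Y -> T) (s : X + Y) : T :=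
  match s with inl x => v x | inr y => w y end.

Fixpoint sat M (X : Type) (phi : formula X) : (X -> {vspace V}) -> Prop :=
  match phi with
  | FPoint x => fun v => points M (v x)
  | FLine x => fun v => lines M (v x)
  | FInc x y => fun v =>
      [/\ points M (v x), lines M (v y) & (v x <= v y)%VS]
  | FEq x y => fun v => v x = v y
  | FNot f => fun v => ~ sat M f v
  | FAnd f g => fun v => sat M f v /\ sat M g v
  | FEx f => fun v => exists2 U, element M U & sat M f (scons U v)
  end.

Definition codes M k (D : formula 'I_k) (a : k.-tuple {vspace V}) : Prop :=
  (forall i, element M (tnth a i)) /\ sat M D (tnth a).

(* A representation of the subspaces satisfying S by the tuples of elements of
   M in a definable set, modulo a definable equivalence relation; [decode] maps
   a tuple to the subspace it represents. *)
Record coding M (S : {vspace V} -> Prop) := Coding {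
  arity : nat;
  code_dom : formula 'I_arity;
  code_eq : formula ('I_arity + 'I_arity);
  decode : arity.-tuple {vspace V} -> {vspace V};
  decode_in : forall a, codes M code_dom a -> S (decode a);
  decode_onto : forall U, S U -> exists2 a, codes M code_dom a & decode a = U;
  code_eqP : forall a b, codes M code_dom a -> codes M code_dom b ->
    (sat M code_eq (sjoin (tnth a) (tnth b)) <-> decode a = decode b)
}.

#[local] Arguments decode {M S} c a.

Definition isolated_point M U : Prop :=
  points M U /\ forall W, lines M W -> ~~ (U <= W)%VS.

(* Isolated points of M are left out: permuting them, with all other elements
   of M fixed, is an automorphism of M, so formulas cannot tell them apart. In
   [structG xi (n - 2)], with n >= 4, they are the orthogonals of the regular
   lines contained in H. There are several of them, distinguished by the points
   of [structB1 xi] that they contain, whereas such a point is determined by the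
   lines of [structG xi (n - 2)] through it; hence no formula can define its
   inclusion in isolated points. *)
Definition inclusions_definable M S (c : coding M S) : Prop :=
  (exists phi : formula (option 'I_(arity c)), forall a U,
     codes M (code_dom c) a -> element M U -> ~ isolated_point M U ->
     (sat M phi (scons U (tnth a)) <-> (decode c a <= U)%VS)) /\
  (exists phi : formula (option 'I_(arity c)), forall a U,
     codes M (code_dom c) a -> element M U -> ~ isolated_point M U ->
     (sat M phi (scons U (tnth a)) <-> (U <= decode c a)%VS)).

Definition definable_in N M : Prop :=
  exists (cP : coding M (points N)) (cL : coding M (lines N)),
    [/\ exists phi : formula ('I_(arity cP) + 'I_(arity cL)), forall a b,
          codes M (code_dom cP) a -> codes M (code_dom cL) b ->
          (sat M phi (sjoin (tnth a) (tnth b))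
             <-> (decode cP a <= decode cL b)%VS),
        inclusions_definable cP
      & inclusions_definable cL].

End Definability.

Arguments decode {F V M S} c a.

(* Main.v *)
Require Import Defs.
From HB Require Import structures.
From mathcomp Require Import all_boot all_order all_algebra.
From mathcomp Require Import zify ring.
From Stdlib Require Import Classical.

Set Implicit Arguments.
Unset Strict Implicit.
Unset Printing Implicit Defensive.

Import GRing.Theory.
Local Open Scope ring_scope.

(** Squaring is an automorphism of a perfect field of characteristic 2, so
    u |-> xi u u is the square of a linear form lam, and lam u = xi u b for a
    vector b, which spans the pole. Regular points are spanned by the vectors of
    the affine space A : lam x = 1. The Gram determinant of x, y is the square
    of the value at x, y of the alternating form
      delta x y = lam x * lam y + xi x y,
    so that a plane spanned by x and y is regular exactly when delta x y is not
    zero ([delta_regular], [regular_delta]).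

    Taking orthogonals turns the Grassmannian of regular secunda and hyperplanes
    into the geometry of regular points and regular lines. Its lines are the
    hyperplanes x^perp with x in A, and two distinct ones contain a common
    regular secundum exactly when delta x y <> 0 ([collP]). So formulas can
    speak of the vanishing of delta, and of the affine lines in A on which delta
    is nondegenerate.

    It is tempting to represent a point p by the hyperplane p^perp, but then the
    inclusion of p in a regular hyperplane becomes orthogonality of regular
    points, and this is not definable in general. When lam b = 1, the maps which
    fix b and multiply the vectors of H = b^perp by a scalar other than 0 and 1
    preserve regular points and regular lines, but not orthogonality. The
    remedy is to represent p by a pair (X, Q) of regular hyperplanes and to let
    the pair stand for the image of X^perp under a linear map that depends on Q:
    - when lam b = 1, the projection from b onto Q, so that p is the meet of Q
      with the line joining b to X^perp;
    - when lam b = 0, the transvection u |-> u + (lam u) b, whatever Q is.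
    Both maps preserve delta ([delta_twist]), so regular lines are represented
    in the same way by pairs (W, Q) with W a regular secundum.

    What remains is to define the inclusion of the point coded by (X, Q) in a
    regular hyperplane Y = y^perp. Let X = x^perp and Q = q^perp. When lam b = 0
    this inclusion means delta x y = 0 ([dec_sub_pole0]). When lam b = 1 it
    means delta x q = delta x y, and delta x is constant on an affine line as
    soon as it has no zero there; chains of two such lines suffice
    ([dec_sub_pole1]).

    All other inclusions reduce to this one, because a point of B_1, and every
    non-isolated element of the Grassmannian, is the meet of the regular
    hyperplanes that contain it ([meet_of_lines]). *)

(** * Orthogonal complements for a nondegenerate symmetric form *)

Section Orthogonality.

Variables (F : fieldType) (V : vectType F) (xi : {symmetric V}).
Local Notation "''[' u , v ]" := (xi u v : F).
Local Notation "U ^!" := (orthov xi U).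

Lemma dotC u v : '[u, v] = '[v, u].
Proof. by rewrite hermC /= expr0 mul1r. Qed.

Lemma dotDl u v w : '[u + v, w] = '[u, w] + '[v, w].
Proof. exact: linearDl. Qed.

Lemma dotZl a u w : '[a *: u, w] = a * '[u, w].
Proof. exact: linearZl_LR. Qed.

Lemma dotDr u v w : '[w, u + v] = '[w, u] + '[w, v].
Proof. by rewrite dotC dotDl !(dotC w). Qed.

Lemma dotZr a u w : '[w, a *: u] = a * '[w, u].
Proof. by rewrite dotC dotZl (dotC w). Qed.

Definition dotE := (dotDl, dotDr, dotZl, dotZr).

Lemma dot0l w : '[0, w] = 0.
Proof. by rewrite -(scale0r 0) dotZl mul0r. Qed.

Lemma orthovS U W : (U <= W)%VS -> (W^! <= U^!)%VS.
Proof. by move=> sUW; rewrite orthov_sym (subv_trans sUW) // orthov_sym. Qed.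

Lemma orthov_add U W : (U + W)^! = (U^! :&: W^!)%VS.
Proof.
apply/eqP; rewrite eqEsubv subv_cap !orthovS ?addvSl ?addvSr //=.
by rewrite orthovD capvSl capvSr.
Qed.

Lemma dim_orthov_span (s : seq V) :
  (\dim {:V} <= \dim (<<s>>%VS)^! + size s)%N.
Proof.
elim: s => [|u s IHs]; first by rewrite span_nil orthov0 addn0.
rewrite span_cons orthov_add capvC /= addnS -addSn (leq_trans IHs) // leq_add2r.
by have := leq_dim_orthov1 xi u (<<s>>%VS)^!; case: (\dim (<<s>>)^!).
Qed.

Lemma leq_dim_orthov U : (\dim {:V} <= \dim U^! + \dim U)%N.
Proof.
have := dim_orthov_span (vbasis U); rewrite size_tuple.
by rewrite (span_basis (vbasisP U)).
Qed.

Hypothesis hnondeg : nondegenerate xi.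

Lemma dim_orthov U : (\dim U^! + \dim U)%N = \dim {:V}.
Proof.
apply/eqP; rewrite eqn_leq leq_dim_orthov andbT.
have UC : (U + U^C = {:V})%VS by exact: addv_complf.
have dUC : (\dim U + \dim (U^C) = \dim {:V})%N.
  by rewrite -dimv_disjoint_sum ?UC // capv_compl.
have cap0 : (U^! :&: (U^C)^! = 0)%VS by rewrite -orthov_add UC; apply/eqP.
have := dimvS (subvf (U^! + (U^C)^!)%VS).
rewrite dimv_disjoint_sum // => le1; have le2 := leq_dim_orthov (U^C)%VS.
rewrite -(leq_add2r (\dim (U^C) + \dim (U^C)^!)) -addnA (addnC (\dim U)).
rewrite -dUC in le1 le2 *; lia.
Qed.

Lemma orthovK U : (U^!)^! = U.
Proof.
apply/esym/eqP; rewrite eqEdim orthov_sym subvv /=.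
by rewrite -(leq_add2r (\dim U^!)) dim_orthov addnC dim_orthov.
Qed.

Lemma orthov_sub U W : (W^! <= U^!)%VS = (U <= W)%VS.
Proof. by rewrite orthov_sym orthovK. Qed.

Lemma regular_orthov U : regular xi U^! <-> regular xi U.
Proof. by rewrite /regular orthovK capvC. Qed.

Lemma regularP U :
  regular xi U <-> (forall v, v \in U -> v \in U^! -> v = 0).
Proof.
split=> [regU v Uv U'v | H].
  by apply/eqP; rewrite -memv0 -regU memv_cap Uv.
apply/eqP; rewrite -subv0; apply/subvP => v; rewrite memv_cap memv0.
by case/andP=> Uv U'v; apply/eqP/H.
Qed.

Lemma mem_add_lines (x y v : V) :
  reflect (exists s t, v = s *: x + t *: y) (v \in <[x]> + <[y]>)%VS.
Proof.
apply: (iffP memv_addP) => [[_ /vlineP[s ->] [_ /vlineP[t ->] ->]] | [s [t ->]]].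
  by exists s, t.
exists (s *: x); first by rewrite memvZ ?memv_line.
by exists (t *: y); rewrite ?memvZ ?memv_line.
Qed.

Lemma mem_orthov_add x y v :
  (v \in (<[x]> + <[y]>)^!) = ('[v, x] == 0) && ('[v, y] == 0).
Proof. by rewrite orthov_add memv_cap !mem_orthov1. Qed.

Lemma nondegenerateP u : (forall v, '[v, u] = 0) -> u = 0.
Proof.
move=> u0; apply/eqP; rewrite -memv0 -(eqP hnondeg).
by apply/mem_orthovP => v _; rewrite dotC u0.
Qed.

Lemma riesz (f : {linear V -> F^o}) : exists c, forall u, f u = '[u, c].
Proof.
pose K := lker (linfun f).
have KP u : (u \in K) = (f u == 0) by rewrite memv_ker lfunE.
have [K1 | nK] := eqVneq K fullv.
  exists 0 => u; rewrite dotC dot0l.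
  by apply/eqP; rewrite -KP K1 memvf.
have /subvPn[u0 _] : ~~ (fullv <= K)%VS.
  by apply: contra nK; rewrite eqEsubv subvf.
rewrite KP => fu0.
have nK' : K^! != 0%VS.
  by apply: contra nK => /eqP K'0; rewrite -(orthovK K) K'0 orthov0.
set c := vpick K^!; have nc : c != 0 by rewrite vpick0.
have fE u : '[u, c] = f u / f u0 * '[u0, c].
  have : u - (f u / f u0) *: u0 \in K.
    by rewrite KP linearB linearZ /= [_ *: _]divfK // subrr.
  move=> Ku; have /mem_orthovP/(_ _ Ku) := memv_pick K^!.
  rewrite (dotC _ (u - _)) -/c -scaleNr !dotE mulNr => uc; apply/eqP.
  by rewrite -subr_eq0 uc.
have u0c : '[u0, c] != 0.
  apply: contra nc => /eqP u0c; apply/eqP/nondegenerateP => v.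
  by rewrite fE u0c mulr0.
exists ((f u0 / '[u0, c]) *: c) => u.
have E (p q r : F) : q != 0 -> r != 0 -> p = q / r * (p / q * r).
  by move=> nq nr; field; apply/andP.
by rewrite dotZr (fE u); apply: E.
Qed.

Hypothesis hchar : 2%N \in [pchar F].
Hypothesis hperf : perfect_field F.

Lemma char2 : (2%:R : F) = 0.
Proof. by have /andP[_ /eqP] := hchar. Qed.

Lemma addff (x : F) : x + x = 0.
Proof. exact: addrr_pchar2. Qed.

Lemma addv_char2 (v : V) : v + v = 0.
Proof. by rewrite -mulr2n -scaler_nat char2 scale0r. Qed.

Lemma sqr_inj_char2 (x y : F) : x ^+ 2 = y ^+ 2 -> x = y.
Proof.
move=> xy; have : (x - y) ^+ 2 == 0.
  by rewrite sqrrB xy -mulr_natl char2 mul0r subr0 addff.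
by rewrite expf_eq0 subr_eq0 => /eqP.
Qed.

(** The square roots of xi u u depend linearly on u, since squaring is additive
    and injective in characteristic 2 and kills the term 2 (xi u v). *)
Lemma exists_pole_vector : exists b, forall u, '[u, u] = '[u, b] ^+ 2.
Proof.
have sqrtP x : exists y : F, y ^+ 2 == x.
  by have [y <-] := hperf hchar x; exists y.
pose f u : F^o := xchoose (sqrtP '[u, u]).
have fP u : f u ^+ 2 = '[u, u] :> F by apply/eqP; exact: xchooseP (sqrtP _).
have f_lin : linear f.
  move=> a u v; apply: sqr_inj_char2; rewrite fP !dotE (dotC v u).
  rewrite sqrrD -mulr_natr char2 mulr0 addr0 exprMn !fP.
  by ring: char2.
pose fl : {linear V -> F^o} :=
  HB.pack f (GRing.isLinear.Build F V F^o *:%R f f_lin).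
have [b bP] := riesz fl.
by exists b => u; rewrite -bP fP.
Qed.

End Orthogonality.

(** * Closure properties of definable relations *)

Section FirstOrder.

Variables (F : fieldType) (V : vectType F) (M : structure V).

(** Relations are handled as predicates on valuations of an arbitrary variable
    type; this makes substitution of variables a mere change of arguments, and
    no operation on formulas is ever needed. *)
Definition definable (X : Type) (P : (X -> {vspace V}) -> Prop) : Prop :=
  exists phi : formula X, forall v, (forall x, element M (v x)) ->
    (sat M phi v <-> P v).

Section Connectives.
Variable X : Type.
Implicit Types P Q : (X -> {vspace V}) -> Prop.

Lemma def_iff P Q :
  (forall v, (forall x, element M (v x)) -> (P v <-> Q v)) ->
  definable Q -> definable P.
Proof. by move=> PQ [phi phiP]; exists phi => v Mv; rewrite phiP // PQ. Qed.

Lemma def_point x : definable (fun v : X -> _ => points M (v x)).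
Proof. by exists (FPoint x). Qed.

Lemma def_line x : definable (fun v : X -> _ => lines M (v x)).
Proof. by exists (FLine x). Qed.

Lemma def_inc x y : definable
  (fun v : X -> _ => [/\ points M (v x), lines M (v y) & (v x <= v y)%VS]).
Proof. by exists (FInc x y). Qed.

Lemma def_eq x y : definable (fun v : X -> _ => v x = v y).
Proof. by exists (FEq x y). Qed.

Lemma def_not P : definable P -> definable (fun v => ~ P v).
Proof. by case=> phi phiP; exists (FNot phi) => v Mv /=; rewrite phiP. Qed.

Lemma def_and P Q : definable P -> definable Q -> definable (fun v => P v /\ Q v).
Proof.
move=> [phi phiP] [psi psiP]; exists (FAnd phi psi) => v Mv /=.
by rewrite phiP // psiP.
Qed.

Lemma def_or P Q : definable P -> definable Q -> definable (fun v => P v \/ Q v).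
Proof.
move=> dP dQ; apply: (@def_iff _ (fun v => ~ (~ P v /\ ~ Q v))).
  by move=> v _; split=> [[] PQ [] // | /not_and_or[] /NNPP]; [left | right].
by apply: def_not; apply: def_and; apply: def_not.
Qed.

Lemma def_imp P Q : definable P -> definable Q -> definable (fun v => P v -> Q v).
Proof.
move=> dP dQ; apply: (@def_iff _ (fun v => ~ P v \/ Q v)).
  by move=> v _; split=> [/imply_to_or | [] // nP /nP].
by apply: def_or => //; apply: def_not.
Qed.

Lemma def_equiv P Q : definable P -> definable Q ->
  definable (fun v => P v <-> Q v).
Proof. by move=> dP dQ; apply: def_and; apply: def_imp. Qed.

Lemma def_and3 P Q R : definable P -> definable Q -> definable R ->
  definable (fun v => [/\ P v, Q v & R v]).
Proof.
move=> dP dQ dR; apply: (@def_iff _ (fun v => P v /\ (Q v /\ R v))).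
  by move=> v _; split=> [[] | [? []]].
by do 2?apply: def_and.
Qed.

(** A closed formula is needed here, as the variable type may be empty. *)
Lemma def_false : definable (fun _ : X -> {vspace V} => False).
Proof.
pose phi := FEx (FEq (None : option X) None).
by exists (FAnd phi (FNot phi)) => v _; split=> // -[].
Qed.

End Connectives.

Lemma def_ex X (Q : {vspace V} -> (X -> {vspace V}) -> Prop) :
  definable (fun w : option X -> _ => Q (w None) (fun x => w (Some x))) ->
  definable (fun v => exists2 U, element M U & Q U v).
Proof.
case=> phi phiP; exists (FEx phi) => v Mv /=.
by split=> -[U MU QU]; exists U => //; apply/(phiP (scons U v)) => // -[].
Qed.

Lemma def_ex_line X (Q : {vspace V} -> (X -> {vspace V}) -> Prop) :
  definable (fun w : option X -> _ => Q (w None) (fun x => w (Some x))) ->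
  definable (fun v => exists2 U, lines M U & Q U v).
Proof.
move=> dQ; apply: (@def_iff _ _ (fun v =>
  exists2 U, element M U & lines M U /\ Q U v)).
  move=> v _; split=> [[U lU QU] | [U _ [lU QU]]]; exists U => //.
  by right.
by apply: def_ex; apply: def_and => //; apply: def_line.
Qed.

Lemma def_ex_point X (Q : {vspace V} -> (X -> {vspace V}) -> Prop) :
  definable (fun w : option X -> _ => Q (w None) (fun x => w (Some x))) ->
  definable (fun v => exists2 U, points M U & Q U v).
Proof.
move=> dQ; apply: (@def_iff _ _ (fun v =>
  exists2 U, element M U & points M U /\ Q U v)).
  move=> v _; split=> [[U lU QU] | [U _ [lU QU]]]; exists U => //.
  by left.
by apply: def_ex; apply: def_and => //; apply: def_point.
Qed.

Lemma def_all_line X (Q : {vspace V} -> (X -> {vspace V}) -> Prop) :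
  definable (fun w : option X -> _ => Q (w None) (fun x => w (Some x))) ->
  definable (fun v => forall U, lines M U -> Q U v).
Proof.
move=> dQ; apply: (@def_iff _ _ (fun v => ~ exists2 U, lines M U & ~ Q U v)).
  move=> v _; split=> [H [U lU]|H U lU]; first by apply; apply: H.
  by apply: NNPP => nQ; apply: H; exists U.
by apply: def_not; apply: def_ex_line; apply: def_not.
Qed.

End FirstOrder.

(** * The pole and the alternating form delta *)

Section Geometry.

Variables (F : fieldType) (V : vectType F) (xi : {symmetric V}) (b : V).
Local Notation "''[' u , v ]" := (xi u v : F).
Local Notation "U ^!" := (orthov xi U).
Local Notation lam u := (xi u b : F).

Hypothesis hnondeg : nondegenerate xi.
Hypothesis hchar : 2%N \in [pchar F].
Hypothesis hb : forall u, '[u, u] = lam u ^+ 2.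

Let c2 : 2%:R = 0 :> F := char2 hchar.

(** The value lam b is its own square. It is 0 when the pole lies on H, and 1
    when it does not. *)
Lemma pole_norm : lam b = 0 \/ lam b = 1.
Proof.
have /eqP := hb b; rewrite -subr_eq0 expr2 -{1}(mulr1 (lam b)) -mulrBr mulf_eq0.
case/orP=> [/eqP ->|]; [by left | right].
by apply/eqP; rewrite eq_sym -subr_eq0.
Qed.

Definition delta x y : F := lam x * lam y + '[x, y].

Lemma deltaC x y : delta x y = delta y x.
Proof. by rewrite /delta mulrC (dotC _ x y). Qed.

Lemma deltaxx x : delta x x = 0.
Proof. by rewrite /delta hb addff. Qed.

Lemma deltaDr x y z : delta x (y + z) = delta x y + delta x z.
Proof. by rewrite /delta !dotE; ring. Qed.

Lemma deltaZr x a y : delta x (a *: y) = a * delta x y.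
Proof. by rewrite /delta !dotE; ring. Qed.

Lemma deltaDl x y z : delta (y + z) x = delta y x + delta z x.
Proof. by rewrite /delta !dotE; ring. Qed.

Lemma deltaZl x a y : delta (a *: y) x = a * delta y x.
Proof. by rewrite /delta !dotE; ring. Qed.

Definition deltaE := (deltaDr, deltaDl, deltaZl, deltaZr, deltaxx).

Lemma dim_plane (x y : V) : x != 0 -> y \notin <[x]>%VS ->
  \dim (<[x]> + <[y]>) = 2%N.
Proof.
move=> nx xy; apply/eqP; rewrite eqn_leq.
have := (dimv_add_leqif <[x]>%VS <[y]>%VS); rewrite !dim_vline nx => -[le2 _].
have -> : (\dim (<[x]> + <[y]>) <= 2)%N.
  by rewrite (leq_trans le2) // ?leq_add2l; case: (y != 0).
rewrite ltnNge; apply: contra xy => le1.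
have /eqP -> : (<[x]> == <[x]> + <[y]>)%VS.
  by rewrite eqEdim addvSl (leq_trans le1) // dim_vline nx.
by rewrite memvE addvSr.
Qed.

Lemma pointP p : \dim p = 1%N -> exists2 x : V, x != 0 & p = <[x]>%VS.
Proof.
move=> p1; have nx : vpick p != 0 by rewrite vpick0 -dimv_eq0 p1.
exists (vpick p) => //; apply/eqP; rewrite eq_sym eqEdim -memvE memv_pick.
by rewrite dim_vline nx p1.
Qed.

Lemma affine_neq0 x : lam x = 1 -> x != 0.
Proof.
by move=> lx; apply/eqP => x0; move/eqP: lx; rewrite x0 dot0l eq_sym oner_eq0.
Qed.

Lemma regular_pointP p :
  regular_subspaces xi 1 p <-> exists2 x, lam x = 1 & p = <[x]>%VS.
Proof.
split=> [[/pointP[x nx ->] /regularP regx] | [x lx ->]].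
  have nl : lam x != 0.
    apply: contra nx => /eqP l0; apply/eqP/regx; first exact: memv_line.
    by rewrite mem_orthov1 hb l0 expr0n.
  exists ((lam x)^-1 *: x); first by rewrite dotZl mulVf.
  apply/eqP; rewrite eq_sym eqEdim -memvE memvZ ?memv_line //=.
  by rewrite !dim_vline nx scaler_eq0 invr_eq0 negb_or nl nx.
split; first by rewrite dim_vline affine_neq0.
apply/regularP => _ /vlineP[a ->]; rewrite mem_orthov1 dotZl hb lx expr1n mulr1.
by move=> /eqP ->; rewrite scale0r.
Qed.

(** Multiplying the Gram system by its adjugate shows that both coordinates of a
    vector of the radical are killed by the Gram determinant, which is
    lam(x)^2 lam(y)^2 + xi(x,y)^2 = delta(x,y)^2 in characteristic 2. *)
Lemma delta_regular x y :
  delta x y != 0 -> regular_subspaces xi 2 (<[x]> + <[y]>)%VS.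
Proof.
move=> nd; split.
  apply: dim_plane.
    by apply: contra nd => /eqP ->; rewrite /delta !dot0l mul0r addr0.
  by apply: contra nd => /vlineP[a ->]; rewrite !deltaE mulr0.
apply/regularP => _ /mem_add_lines[s [t ->]].
rewrite mem_orthov_add !dotE !hb => /andP[/eqP e1 /eqP e2].
have s0 : s * delta x y ^+ 2 = 0.
  transitivity (lam y ^+ 2 * (s * lam x ^+ 2 + t * '[y, x])
      + '[x, y] * (s * '[x, y] + t * lam y ^+ 2)); last by rewrite e1 e2; ring.
  by rewrite /delta (dotC _ y x); ring: c2.
have t0 : t * delta x y ^+ 2 = 0.
  transitivity (lam x ^+ 2 * (s * '[x, y] + t * lam y ^+ 2)
      + '[x, y] * (s * lam x ^+ 2 + t * '[y, x])); last by rewrite e1 e2; ring.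
  by rewrite /delta (dotC _ y x); ring: c2.
have {}s0 : s = 0.
  by apply/eqP; move/eqP: s0; rewrite mulf_eq0 expf_eq0 (negPf nd) orbF.
have {}t0 : t = 0.
  by apply/eqP; move/eqP: t0; rewrite mulf_eq0 expf_eq0 (negPf nd) orbF.
by rewrite s0 t0 !scale0r addr0.
Qed.

(** If delta x y = 0 then lam(y) x + y is orthogonal to both x and y. *)
Lemma regular_delta x y : lam x = 1 -> y \notin <[x]>%VS ->
  regular xi (<[x]> + <[y]>)%VS -> delta x y != 0.
Proof.
move=> lx xy /regularP reg; apply: contra xy; rewrite /delta lx mul1r => /eqP d0.
have E : '[x, y] = lam y.
  by apply/eqP; rewrite -subr_eq0 (oppr_pchar2 hchar) addrC d0.
have v0 : lam y *: x + y = 0.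
  apply: reg; first by apply/mem_add_lines; exists (lam y), 1; rewrite scale1r.
  rewrite mem_orthov_add !dotE (dotC _ y x) !hb lx E.
  by apply/andP; split; apply/eqP; ring: c2.
have -> : y = - lam y *: x by apply/eqP; rewrite scaleNr -addr_eq0 addrC v0.
by rewrite memvZ ?memv_line.
Qed.

(** If x spans the pole, then x^perp lies in b^perp, so b is a multiple of x, and
    lam x = 1 forces the scalar to be 1. *)
Lemma poleP x : lam x = 1 -> is_pole xi <[x]>%VS <-> x = b.
Proof.
move=> lx; split=> [[_ polex] | xb].
  have sxb : (<[x]>^! <= <[b]>^!)%VS.
    apply/subvP => u ux; rewrite mem_orthov1.
    have [-> | nu] := eqVneq u 0; first by rewrite dot0l.
    have du : \dim <[u]> = 1%N by rewrite dim_vline nu.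
    have /polex : (\dim <[u]> = 1)%N by [].
    case=> /(_ ux) [_]; rewrite /perp orthov11 hb => + _.
    by rewrite expf_eq0.
  move: sxb; rewrite orthov_sub // => /vlineP[a ba].
  have : '[x, x] = 1 by rewrite hb lx expr1n.
  move: (lx); rewrite {1}ba dotZr => + xx; rewrite xx mulr1 => a1.
  by rewrite ba a1 scale1r.
split=> [|p /pointP[u nu ->]]; first by rewrite dim_vline affine_neq0.
rewrite /selfconjugate /perp !orthov11 dim_vline nu hb xb expf_eq0 /=.
by split=> [//|[]].
Qed.

Lemma B1_pointP p :
  points (structB1 xi) p <-> exists x, [/\ lam x = 1, x <> b & p = <[x]>%VS].
Proof.
split=> [[/regular_pointP[x lx ->]] np | [x [lx nb ->]]].
  by exists x; split=> // xb; apply: np; apply/poleP.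
by split; [apply/regular_pointP; exists x | move/(poleP lx)].
Qed.

(** A line of B_1 has a vector x in A; adding a multiple of x to a second basis
    vector brings that one into A without changing delta. *)
Lemma B1_lineP L : lines (structB1 xi) L <->
  exists x y, [/\ lam x = 1, lam y = 1, delta x y != 0 & L = (<[x]> + <[y]>)%VS].
Proof.
split=> [[[dL regL] nH] | [x [y [lx ly nd ->]]]].
  have [LH | /subvPn[x0 Lx0]] := boolP (L <= <[b]>^!)%VS.
    case: nH => p /pointP[u nu ->]; rewrite -memvE => Lu.
    split; first by rewrite dim_vline nu.
    rewrite /perp orthov11 hb expf_eq0 /= -mem_orthov1.
    exact: (subvP LH).
  rewrite mem_orthov1 => nx0.
  pose x := (lam x0)^-1 *: x0.
  have lx : lam x = 1 by rewrite dotZl mulVf.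
  have Lx : x \in L by rewrite memvZ.
  have /subvPn[y0 Ly0 xy0] : ~~ (L <= <[x]>)%VS.
    by apply/negP => /dimvS; rewrite dL dim_vline affine_neq0.
  pose y := y0 + (1 - lam y0) *: x.
  have ly : lam y = 1 by rewrite dotDl dotZl lx; ring.
  have xy : y \notin <[x]>%VS.
    apply: contra xy0 => xy; rewrite -[y0](addrK ((1 - lam y0) *: x)).
    by rewrite memvB // memvZ ?memv_line.
  have Ly : y \in L by rewrite memvD // memvZ.
  have LE : L = (<[x]> + <[y]>)%VS.
    apply/esym/eqP; rewrite eqEdim subv_add -!memvE Lx Ly dL dim_plane //.
    exact: affine_neq0.
  exists x, y; split=> //; apply: regular_delta => //; by rewrite -LE.
split; first exact: delta_regular.
move=> /(_ <[x]>%VS); rewrite dim_vline affine_neq0 // addvSl.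
move=> /(_ erefl isT)[_].
by rewrite /perp orthov11 hb lx expr1n oner_eq0.
Qed.

Lemma lam_plane x y s t : lam x = 1 -> lam y = 1 -> lam (s *: x + t *: y) = s + t.
Proof. by move=> lx ly; rewrite !dotE lx ly !mulr1. Qed.

Lemma affine_vector_inj x y : lam x = 1 -> lam y = 1 -> y \in <[x]>%VS -> x = y.
Proof.
move=> lx ly /vlineP[a E]; move: ly; rewrite E dotZl lx mulr1 => ->.
by rewrite scale1r.
Qed.

(** * The Grassmannian as dual of the regular points and lines *)

Hypothesis hn : (3 <= \dim {:V})%N.
Let M := structG xi (\dim {:V} - 2).

Lemma hyperplane_orthov X : lines M X <-> regular_subspaces xi 1 X^!.
Proof.
rewrite /= /regular_subspaces (regular_orthov hnondeg).
have := dim_orthov hnondeg X.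
by split=> -[dX ?]; split=> //; lia.
Qed.

Lemma secundum_orthov W : points M W <-> regular_subspaces xi 2 W^!.
Proof.
rewrite /= /regular_subspaces (regular_orthov hnondeg).
have := dim_orthov hnondeg W.
by split=> -[dX ?]; split=> //; lia.
Qed.

Lemma hyperplaneP X : lines M X <-> exists2 x, lam x = 1 & X = <[x]>^!.
Proof.
rewrite hyperplane_orthov regular_pointP; split=> -[x lx E]; exists x => //.
  by rewrite -E orthovK.
by rewrite E orthovK.
Qed.

(** W lies in x^perp exactly when x lies in W^perp, so these are the secunda W for
    which W^perp is a line of B_1. *)
Definition nonisolated W := points M W /\ exists2 X, lines M X & (W <= X)%VS.

Lemma nonisolated_secundumP W : nonisolated W <->
  exists x y, [/\ lam x = 1, lam y = 1, delta x y != 0 & W = (<[x]> + <[y]>)^!].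
Proof.
split=> [[/secundum_orthov rW [_ /hyperplaneP[x lx ->]]] | [x [y [lx ly nd ->]]]].
  rewrite orthov_sym // -memvE => Wx.
  have /B1_lineP[x1 [y [lx1 ly nd E]]] : lines (structB1 xi) W^!.
    split=> // /(_ <[x]>%VS); rewrite dim_vline affine_neq0 // -memvE.
    move=> /(_ erefl Wx)[_].
    by rewrite /perp orthov11 hb lx expr1n oner_eq0.
  by exists x1, y; split=> //; rewrite -E orthovK.
split; first by apply/secundum_orthov; rewrite orthovK //; apply: delta_regular.
by exists <[x]>^!; [apply/hyperplaneP; exists x | rewrite orthovS ?addvSl].
Qed.

Definition visible U := lines M U \/ nonisolated U.

Lemma element_visible U :
  element M U -> ~ isolated_point M U -> visible U.
Proof.
case=> [pU nU | lU _]; [right; split=> // | by left].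
apply: NNPP => H; apply: nU; split=> // W lW.
by apply/negP => UW; apply: H; exists W.
Qed.

(** The regular hyperplanes through a secundum are parametrized by an affine
    line of A; in characteristic 2 its direction is x + y. *)
Lemma hyperplane_aboveP x y X : lam x = 1 -> lam y = 1 ->
  lines M X /\ ((<[x]> + <[y]>)^! <= X)%VS <->
  exists t, X = <[x + t *: (x + y)]>^!.
Proof.
move=> lx ly; split=> [[/hyperplaneP[z lz ->]] | [t ->]].
  rewrite (orthov_sub hnondeg) -memvE => /mem_add_lines[s [t E]].
  exists t; congr (<[_]>%VS)^!; rewrite E.
  have st : s + t = 1 by rewrite -lz E lam_plane.
  rewrite -{2}[x]scale1r -st scalerDr scalerDl addrA -(addrA (s *: x)).
  by rewrite addv_char2 // addr0.
have E : x + t *: (x + y) = (1 + t) *: x + t *: y.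
  by rewrite scalerDr scalerDl scale1r addrA.
split.
  apply/hyperplaneP; exists (x + t *: (x + y)) => //.
  by rewrite E lam_plane // -addrA addff // addr0.
by rewrite (orthov_sub hnondeg) -memvE; apply/mem_add_lines; exists (1 + t), t.
Qed.

(** Dually: the poles of X and Y are distinct and joined by a regular line. *)
Definition coll X Y := X <> Y /\
  exists2 W, points M W & lines M X /\ lines M Y /\ (W <= X)%VS /\ (W <= Y)%VS.

Lemma collP x y : lam x = 1 -> lam y = 1 ->
  coll <[x]>^! <[y]>^! <-> delta x y != 0.
Proof.
move=> lx ly; split=> [[nxy [W /secundum_orthov[dW rW]]] | nd].
  move=> [_ [_]]; rewrite !(orthov_sym _ W) -!memvE => -[Wx Wy].
  have xy : y \notin <[x]>%VS.
    by apply/negP => /(affine_vector_inj lx ly) E; apply: nxy; rewrite E.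
  apply: regular_delta => //; suff <- : W^! = (<[x]> + <[y]>)%VS by [].
  apply/esym/eqP; rewrite eqEdim subv_add -!memvE Wx Wy dW dim_plane //.
  exact: affine_neq0.
split.
  move/(congr1 (orthov xi)); rewrite !(orthovK hnondeg) => E.
  have := memv_line y; rewrite -E => /(affine_vector_inj lx ly) xy.
  by move: nd; rewrite xy deltaxx eqxx.
have [pW _] : nonisolated (<[x]> + <[y]>)^!.
  by apply/nonisolated_secundumP; exists x, y.
exists (<[x]> + <[y]>)^! => //; rewrite !orthovS ?addvSl ?addvSr //.
by split; [|split] => //; apply/hyperplaneP; [exists x | exists y].
Qed.

(** This is how a formula expresses that an affine function is constant on a
    line: it only has to say that the function has no zero there. *)
Lemma constant_of_avoids (a d : F) : (forall t, a + t * d != 0) -> d = 0.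
Proof.
move=> H; apply/eqP/negP => /negP nd; have /eqP := H (- a / d); apply.
by rewrite divfK // subrr.
Qed.

(** * Maps centred at the pole that preserve delta *)

Definition twist_fun c u := u + '[u, c] *: b.

Fact twist_linear c : linear (twist_fun c).
Proof.
move=> a u v; rewrite /twist_fun !dotE scalerDl scalerDr scalerA.
by rewrite addrACA.
Qed.

HB.instance Definition _ c :=
  GRing.isLinear.Build F V V *:%R (twist_fun c) (twist_linear c).

Definition twist c : 'End(V) := linfun (twist_fun c).

Lemma twistE c u : twist c u = u + '[u, c] *: b.
Proof. by rewrite lfunE. Qed.

(** In the first case [twist c] is the projection from b onto c^perp, in the
    second one the transvection with centre b and axis H. *)
Definition good_twist c := (lam b = 1 /\ lam c = 1) \/ (lam b = 0 /\ c = b).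

(** For lam b = 1 vectors are changed by multiples of b, which spans the radical
    of delta. For lam b = 0 the transvection is an isometry of xi that preserves
    lam. *)
Lemma delta_twist c x y : good_twist c ->
  delta (twist c x) (twist c y) = delta x y.
Proof.
rewrite !twistE /delta !dotE (dotC _ b y) => -[[b1 _] | [b0 ->]].
  by rewrite b1; ring: c2.
by rewrite b0 !mulr0 !addr0 (mulrC (lam y)) -!addrA addff // addr0.
Qed.

Lemma lam_twist c x : lam (twist c x) = lam x + '[x, c] * lam b.
Proof. by rewrite twistE !dotE. Qed.

(** For lam b = 1 only b itself could be projected to a multiple of b, but the
    projection kills b. For lam b = 0 the form lam vanishes on multiples of b. *)
Lemma twist_neq_pole c x : good_twist c -> lam x = 1 -> lam (twist c x) != 0 ->
  twist c x <> lam (twist c x) *: b.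
Proof.
move=> gc lx nl E; move/eqP: nl; apply.
case: gc => -[lb lc]; last by rewrite E dotZl lb mulr0.
have xE : x = (lam (twist c x) - '[x, c]) *: b.
  by rewrite scalerBl -E twistE addrK.
have e1 : lam (twist c x) - '[x, c] = 1 by rewrite -lx [in RHS]xE dotZl lb mulr1.
have xb : x = b by rewrite xE e1 scale1r.
by rewrite lam_twist xb lb dotC lc mulr1 addff.
Qed.

Lemma twist_B1_point c x : good_twist c -> lam x = 1 -> lam (twist c x) != 0 ->
  points (structB1 xi) <[twist c x]>%VS.
Proof.
move=> gc lx nl; apply/B1_pointP; exists ((lam (twist c x))^-1 *: twist c x).
split; first by rewrite dotZl mulVf.
  move=> E; apply: (twist_neq_pole gc lx nl).
  by move/(congr1 ( *:%R (lam (twist c x)))): E; rewrite scalerKV.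
apply/eqP; rewrite eqEdim -memvE -{1}[twist c x](scalerKV nl).
by rewrite memvZ ?memv_line // !dim_vline scaler_eq0 invr_eq0 (negPf nl) /=.
Qed.

(** * Coding points and lines of B_1 *)

Definition affine_rep Q := let v := vpick Q^! in (lam v)^-1 *: v.

Lemma affine_repE q : lam q = 1 -> affine_rep <[q]>^! = q.
Proof.
move=> lq; rewrite /affine_rep orthovK //.
have /vlineP[a E] := memv_pick <[q]>%VS.
have na : a != 0.
  have : vpick <[q]>%VS != 0 by rewrite vpick0 -dimv_eq0 dim_vline affine_neq0.
  by rewrite E scaler_eq0 negb_or => /andP[].
by rewrite E dotZl lq mulr1 scalerK.
Qed.

Definition twist_vec Q := if lam b == 0 then b else affine_rep Q.

Lemma twist_vec_good Q : lines M Q -> good_twist (twist_vec Q).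
Proof.
move=> /hyperplaneP[q lq ->]; rewrite /twist_vec /good_twist affine_repE //.
case: pole_norm => ->; first by rewrite eqxx; right.
by rewrite oner_eq0; left.
Qed.

(** The subspace that the pair (U, Q) stands for, U being a hyperplane in a code
    of a point and a secundum in a code of a line. *)
Definition dec U Q := (twist (twist_vec Q) @: U^!)%VS.

Lemma dec_point x Q : dec <[x]>^! Q = <[twist (twist_vec Q) x]>%VS.
Proof. by rewrite /dec orthovK // limg_line. Qed.

Lemma dec_line x y Q : dec (<[x]> + <[y]>)^! Q =
  (<[twist (twist_vec Q) x]> + <[twist (twist_vec Q) y]>)%VS.
Proof. by rewrite /dec orthovK // limgD !limg_line. Qed.

(** A pair of regular hyperplanes codes a point of B_1 as soon as it decodes to a
    point off H. *)
Definition point_code X Q :=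
  [/\ lines M X, lines M Q & ~~ (dec X Q <= <[b]>^!)%VS].

Lemma point_codeP x Q : lam x = 1 -> lines M Q ->
  point_code <[x]>^! Q <-> lam (twist (twist_vec Q) x) != 0.
Proof.
move=> lx lQ; rewrite /point_code dec_point orthov11; split=> [[]// | nl].
by split=> //; apply/hyperplaneP; exists x.
Qed.

Lemma point_code_point X Q : point_code X Q -> points (structB1 xi) (dec X Q).
Proof.
move=> cX; have [/hyperplaneP[x lx E] lQ _] := cX; subst X.
move/(point_codeP lx lQ): cX => nl; rewrite dec_point.
by apply: twist_B1_point => //; apply: twist_vec_good.
Qed.

(** All hyperplanes through W are required to give codes of points. When
    lam b = 1 this makes xi _ q constant on the affine line of poles (where
    Q = q^perp), so that the regular points of the decoded line are exactly
    those decoded from hyperplanes through W. *)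
Definition line_code W Q :=
  [/\ nonisolated W, lines M Q &
      forall X, lines M X -> (W <= X)%VS -> point_code X Q].

Lemma line_codeP W Q : line_code W Q -> exists x y,
  [/\ lam x = 1, lam y = 1, delta x y != 0, W = (<[x]> + <[y]>)^!
    & lam (twist (twist_vec Q) x) != 0 /\ lam (twist (twist_vec Q) (x + y)) = 0].
Proof.
case=> /nonisolated_secundumP[x [y [lx ly nd ->]]] lQ H; exists x, y.
have nl t :
    lam (twist (twist_vec Q) x) + t * lam (twist (twist_vec Q) (x + y)) != 0.
  rewrite -dotZl -dotDl -linearZ -linearD /=.
  have [lX WX] : lines M <[x + t *: (x + y)]>^! /\
      ((<[x]> + <[y]>)^! <= <[x + t *: (x + y)]>^!)%VS.
    by apply/hyperplane_aboveP => //; exists t.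
  apply/point_codeP => //; last exact: H.
  by rewrite dotDl dotZl dotDl lx ly addff // mulr0 addr0.
split=> //; split; first by have := nl 0; rewrite mul0r addr0.
exact: constant_of_avoids nl.
Qed.

Lemma line_code_line W Q : line_code W Q -> lines (structB1 xi) (dec W Q).
Proof.
move=> cW; have [_ lQ _] := cW.
have [x [y [lx ly nd -> [nx nxy]]]] := line_codeP cW.
rewrite dec_line; split.
  by apply: delta_regular; rewrite delta_twist //; apply: twist_vec_good.
move/(_ <[twist (twist_vec Q) x]>%VS).
have nT : twist (twist_vec Q) x != 0.
  by apply: contra nx => /eqP ->; rewrite dot0l.
rewrite dim_vline nT addvSl => /(_ erefl isT)[_].
by rewrite /perp orthov11 hb expf_eq0 /= (negPf nx).
Qed.

(** A point of the decoded line comes from a vector s x + t y. The case s + t = 0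
    is that of the direction x + y of the affine line, whose image lies on H. *)
Lemma point_on_line W Q p : line_code W Q -> points (structB1 xi) p ->
  (p <= dec W Q)%VS <-> exists2 X, lines M X /\ (W <= X)%VS & p = dec X Q.
Proof.
move=> cW /B1_pointP[z [lz _ ->]].
have [x [y [lx ly nd -> [nx nxy]]]] := line_codeP cW.
rewrite -memvE dec_line; split; last case=> _ /(hyperplane_aboveP _ lx ly)[t ->].
  move=> /mem_add_lines[s [t E]].
  pose r := s + t; have nr : r != 0.
    apply/eqP => r0; suff : lam z = 0 by rewrite lz => /eqP; rewrite oner_eq0.
    have -> : z = twist (twist_vec Q) (s *: (x + y)).
      have st : s = t by apply/eqP; rewrite -subr_eq0 (oppr_pchar2 hchar) -/r r0.
      by rewrite E st scalerDr linearD !linearZ.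
    by rewrite linearZ dotZl nxy mulr0.
  exists <[x + (r^-1 * t) *: (x + y)]>^!.
    by apply/hyperplane_aboveP => //; exists (r^-1 * t).
  rewrite dec_point.
  have -> : z = r *: twist (twist_vec Q) (x + (r^-1 * t) *: (x + y)).
    rewrite E -!linearZ -linearD; congr (twist _ _).
    rewrite scalerDr scalerA mulrA mulfV // mul1r scalerDr /r scalerDl.
    by rewrite addrA -(addrA _ _ (t *: x)) addv_char2 // addr0.
  apply/eqP; rewrite eqEdim -memvE memvZ ?memv_line //=.
  by rewrite !dim_vline scaler_eq0 (negPf nr).
rewrite dec_point => E; have : z \in <[z]>%VS := memv_line z.
rewrite E => /vlineP[a ->]; apply/mem_add_lines; exists (a * (1 + t)), (a * t).
rewrite -!linearZ -linearD; congr (twist _ _).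
by rewrite scalerDr !scalerA scalerDr mulrDr mulr1 scalerDl addrA.
Qed.

Lemma line_code_sub W Q Z : line_code W Q ->
  (dec W Q <= Z)%VS <->
  (forall X, lines M X -> (W <= X)%VS -> (dec X Q <= Z)%VS).
Proof.
case=> /nonisolated_secundumP[x [y [lx ly nd ->]]] _ _; split.
  move=> sZ X /hyperplaneP[z lz ->]; rewrite (orthov_sub hnondeg) => zL.
  apply: subv_trans sZ.
  by apply: limgS; rewrite !(orthov_sub hnondeg).
move=> H; rewrite dec_line subv_add -!dec_point !H ?orthovS ?addvSl ?addvSr //.
  by apply/hyperplaneP; exists y.
by apply/hyperplaneP; exists x.
Qed.

(** If no vector of A were orthogonal to U, then U^perp would be contained in
    b^perp, that is, b would belong to U. *)
Lemma affine_orthogonal (U : {vspace V}) : b \notin U ->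
  exists2 q, q \in U^! & lam q = 1.
Proof.
rewrite memvE -(orthov_sub hnondeg) => /subvPn[v Uv].
rewrite mem_orthov1 => nv; exists ((lam v)^-1 *: v); first exact: memvZ.
by rewrite dotZl mulVf.
Qed.

(** K^perp is spanned by its vectors in A as soon as there is one: a vector of H
    is the difference of two of them. Hence K is the meet of the regular
    hyperplanes through it. *)
Lemma meet_of_lines K Z : (exists2 q, q \in K^! & lam q = 1) ->
  (Z <= K)%VS <-> (forall Y, lines M Y -> (K <= Y)%VS -> (Z <= Y)%VS).
Proof.
case=> q Kq lq; split=> [ZK Y _ KY | H]; first exact: subv_trans KY.
apply/subvP => u Zu; rewrite -(orthovK hnondeg K).
have H1 v : v \in K^! -> lam v = 1 -> '[u, v] = 0.
  move=> Kv lv; apply/eqP; rewrite -mem_orthov1.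
  have /subvP : (Z <= <[v]>^!)%VS; last exact.
  by apply: H; [apply/hyperplaneP; exists v | rewrite orthov_sym -memvE].
apply/mem_orthovP => v Kv; have [l0 | nl] := eqVneq (lam v) 0.
  have := H1 (v + q); rewrite dotDl dotDr l0 lq add0r (H1 q) // addr0.
  by apply; rewrite ?memvD.
have := H1 ((lam v)^-1 *: v); rewrite dotZl dotZr mulVf //.
move=> /(_ (memvZ _ Kv) erefl).
by move/eqP; rewrite mulf_eq0 invr_eq0 (negPf nl) => /eqP.
Qed.

Lemma affine_orthogonal_element U : visible U ->
  exists2 q, q \in U^! & lam q = 1.
Proof.
case=> [/hyperplaneP[q lq ->] | /nonisolated_secundumP[x [y [lx _ _ ->]]]].
  by exists q; rewrite ?orthovK ?memv_line.
by exists x; rewrite ?orthovK // memvE addvSl.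
Qed.

Lemma pole_neq0 x : lam x = 1 -> b != 0.
Proof.
move=> lx; apply/eqP => b0; move/eqP: lx; rewrite [X in '[x, X]]b0 dotC dot0l.
by rewrite eq_sym oner_eq0.
Qed.

Lemma pole_notin_point x : lam x = 1 -> x <> b -> b \notin <[x]>%VS.
Proof.
move=> lx nxb; apply/negP => /vlineP[a ba]; apply: nxb; rewrite ba.
suff -> : a = 1 by rewrite scale1r.
by rewrite -[RHS]lx [in RHS]ba dotZr hb lx expr1n mulr1.
Qed.

Lemma affine_orthogonal_point p : points (structB1 xi) p ->
  exists2 q, q \in p^! & lam q = 1.
Proof.
case/B1_pointP=> x [lx nxb ->]; apply: affine_orthogonal.
exact: pole_notin_point.
Qed.

Lemma B1_point_eq p q : points (structB1 xi) p -> points (structB1 xi) q ->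
  p = q <-> (forall Y, lines M Y -> (p <= Y)%VS <-> (q <= Y)%VS).
Proof.
move=> /affine_orthogonal_point pP /affine_orthogonal_point qP; split=> [-> // | H].
apply/eqP; rewrite eqEsubv; apply/andP; split.
  by apply/(meet_of_lines _ qP) => Y lY /(H Y lY).
by apply/(meet_of_lines _ pP) => Y lY /(H Y lY).
Qed.

(** For lam b = 0 the transvection is an involution. For lam b = 1 every subspace
    that avoids b lies in some Q = q^perp with q in A, and the projection onto Q
    fixes it pointwise. *)
Lemma twist_onto x y : lam x = 1 -> lam y = 1 ->
  lam b = 0 \/ b \notin (<[x]> + <[y]>)%VS ->
  exists Q x' y', [/\ lines M Q, lam x' = 1, lam y' = 1,
    twist (twist_vec Q) x' = x & twist (twist_vec Q) y' = y].
Proof.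
move=> lx ly; case: pole_norm => lb.
  exists <[x]>^!, (x + b), (y + b); rewrite /twist_vec lb eqxx !twistE !dotDl lb.
  rewrite lx ly !addr0 scale1r -!addrA addv_char2 // !addr0; split=> //.
  by apply/hyperplaneP; exists x.
case=> [/eqP | /affine_orthogonal[q qP lq]]; first by rewrite lb oner_eq0.
exists <[q]>^!, x, y; rewrite /twist_vec lb oner_eq0 affine_repE // !twistE.
move: qP; rewrite mem_orthov_add !(dotC _ q) => /andP[/eqP -> /eqP ->].
by rewrite !scale0r !addr0; split=> //; apply/hyperplaneP; exists q.
Qed.

Lemma point_code_onto p : points (structB1 xi) p ->
  exists X Q, point_code X Q /\ dec X Q = p.
Proof.
case/B1_pointP=> x [lx nxb ->].
have [] := @twist_onto x x lx lx.
  by right; rewrite addvv; apply: pole_notin_point.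
move=> Q [x' [_ [lQ lx' _ Tx _]]]; exists <[x']>^!, Q.
by rewrite dec_point Tx; split=> //; apply/point_codeP; rewrite // Tx lx oner_eq0.
Qed.

(** When lam b = 1, the pole is in the radical of delta, hence on no regular
    line. *)
Lemma line_code_onto L : lines (structB1 xi) L ->
  exists W Q, line_code W Q /\ dec W Q = L.
Proof.
case/B1_lineP=> x [y [lx ly nd ->]].
have [] := @twist_onto x y lx ly.
  case: pole_norm => lb; [by left | right].
  apply/mem_add_lines => -[s [t E]].
  have db z : delta b z = 0 by rewrite /delta lb mul1r (dotC _ b z) addff.
  have := db x; rewrite E !deltaE mulr0 add0r (deltaC y) => /eqP.
  rewrite mulf_eq0 (negPf nd) orbF => /eqP t0.
  have := db y; rewrite E !deltaE mulr0 addr0 => /eqP.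
  rewrite mulf_eq0 (negPf nd) orbF => /eqP s0.
  by move: (pole_neq0 lx); rewrite E s0 t0 !scale0r addr0 eqxx.
move=> Q [x' [y' [lQ lx' ly' Tx Ty]]]; exists (<[x']> + <[y']>)^!, Q.
rewrite dec_line Tx Ty; split=> //; split=> //.
  apply/nonisolated_secundumP; exists x', y'; split=> //.
  by rewrite -(delta_twist _ _ (twist_vec_good lQ)) Tx Ty.
move=> X lX WX; have /(hyperplane_aboveP _ lx' ly')[t ->] := conj lX WX.
apply/point_codeP => //.
  by rewrite dotDl dotZl dotDl lx' ly' addff // mulr0 addr0.
rewrite linearD linearZ linearD /= Tx Ty dotDl dotZl dotDl lx ly addff //.
by rewrite mulr0 addr0 oner_eq0.
Qed.

(** * Inclusion of coded points in regular hyperplanes *)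

Lemma point_code_pole0 X Q : lam b = 0 ->
  point_code X Q <-> lines M X /\ lines M Q.
Proof.
move=> lb; split=> [[] // | [/hyperplaneP[x lx ->] lQ]].
by apply/point_codeP => //; rewrite lam_twist lx lb mulr0 addr0 oner_eq0.
Qed.

(** The decoded point is spanned by x + b, which is orthogonal to y exactly when
    xi x y = 1, that is, when delta x y = 0. *)
Lemma dec_sub_pole0 X Q Y : lam b = 0 -> point_code X Q -> lines M Y ->
  (dec X Q <= Y)%VS <-> ~ coll X Y.
Proof.
move=> lb [/hyperplaneP[x lx ->] _ _] /hyperplaneP[y ly ->].
rewrite dec_point orthov11 collP // /twist_vec lb eqxx twistE lx scale1r dotDl.
rewrite (dotC _ b) /delta lx ly mulr1 addrC.
by split=> [-> // | /negP]; rewrite negbK.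
Qed.

(** The point decoded from x and q is spanned by x + xi(x,q) b. *)
Lemma dec_sub_delta x q y : lam b = 1 -> lam x = 1 -> lam q = 1 -> lam y = 1 ->
  (dec <[x]>^! <[q]>^! <= <[y]>^!)%VS = (delta x q == delta x y).
Proof.
move=> lb lx lq ly; rewrite dec_point orthov11 /twist_vec lb oner_eq0.
rewrite affine_repE // twistE !dotE (dotC _ b) /delta lx lq ly mulr1.
by rewrite (inj_eq (addrI _)) addr_eq0 (oppr_pchar2 hchar) eq_sym mulr1.
Qed.

Lemma point_code_pole1 X Q : lam b = 1 -> point_code X Q <->
  [/\ lines M X, lines M Q & coll X Q].
Proof.
move=> lb.
have lamE x q : lam x = 1 -> lam q = 1 ->
    lam (twist (twist_vec <[q]>^!) x) = delta x q.
  move=> lx lq; rewrite lam_twist /twist_vec lb oner_eq0 affine_repE //.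
  by rewrite /delta lx lq !mulr1.
split=> [cX | [/hyperplaneP[x lx ->] /hyperplaneP[q lq ->]]].
  have [lX lQ _] := cX; split=> //.
  case/hyperplaneP: lX cX => x lx ->; case/hyperplaneP: (lQ) => q lq EQ.
  rewrite EQ in lQ *; move/(point_codeP lx lQ) => nl; apply/collP => //.
  by rewrite -lamE.
move/(collP lx lq) => nd; apply/point_codeP; rewrite // ?lamE //.
by apply/hyperplaneP; exists q.
Qed.

(** With X = x^perp, Q = q^perp and G = g^perp: some regular line of poles
    through q and g carries no zero of delta x, so that delta x takes the same
    value at q and at g. *)
Definition equidistant X Q G := exists2 W, points M W &
  [/\ (W <= Q)%VS, (W <= G)%VS & forall Y, lines M Y -> (W <= Y)%VS -> coll Y X].

Lemma equidistant_delta x q g : lam x = 1 -> lam q = 1 -> lam g = 1 ->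
  equidistant <[x]>^! <[q]>^! <[g]>^! -> delta x q = delta x g.
Proof.
move=> lx lq lg [W _ [Wq Wg H]].
have d0 : delta (q + g) x = 0.
  apply: (@constant_of_avoids (delta q x)) => t.
  have [lY sY] : lines M <[q + t *: (q + g)]>^! /\
      ((<[q]> + <[g]>)^! <= <[q + t *: (q + g)]>^!)%VS.
    by apply/hyperplane_aboveP => //; exists t.
  rewrite -deltaZl -deltaDl; apply/collP => //.
    by rewrite dotDl dotZl dotDl lq lg addff // mulr0 addr0.
  by apply: H => //; apply: subv_trans sY; rewrite orthov_add subv_cap Wq.
apply/eqP; rewrite -subr_eq0 (oppr_pchar2 hchar) -d0 deltaDl.
by rewrite !(deltaC x).
Qed.

Lemma delta_equidistant x q g : lam x = 1 -> lam q = 1 -> lam g = 1 ->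
  delta q g != 0 -> delta x q != 0 -> delta x q = delta x g ->
  equidistant <[x]>^! <[q]>^! <[g]>^!.
Proof.
move=> lx lq lg nd nx E; exists (<[q]> + <[g]>)^!.
  by apply/secundum_orthov; rewrite orthovK //; apply: delta_regular.
split; rewrite ?orthovS ?addvSl ?addvSr // => Y lY WY.
have /(hyperplane_aboveP _ lq lg)[t ->] := conj lY WY.
apply/collP => //; first by rewrite dotDl dotZl dotDl lq lg addff // mulr0 addr0.
by rewrite deltaC deltaDr deltaZr deltaDr -E addff // mulr0 addr0.
Qed.

(** If q and y are not joined by a regular line, then g = q + (x + b) is joined
    to both, and delta x g = delta x q because x and b are delta-orthogonal to
    x. If they are joined, g = y does. *)
Lemma dec_sub_pole1 X Q Y : lam b = 1 -> point_code X Q -> lines M Y ->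
  (dec X Q <= Y)%VS <->
  exists2 G, lines M G & equidistant X Q G /\ equidistant X G Y.
Proof.
move=> lb /(point_code_pole1 _ _ lb)[/hyperplaneP[x lx ->] /hyperplaneP[q lq ->]].
move=> /(collP lx lq) nd /hyperplaneP[y ly ->]; rewrite dec_sub_delta //.
split=> [/eqP E | [_ /hyperplaneP[g lg ->] [H1 H2]]]; last first.
  by rewrite (equidistant_delta lx lq lg H1) (equidistant_delta lx lg ly H2).
have [d0 | ndq] := eqVneq (delta q y) 0; last first.
  have H := delta_equidistant lx lq ly ndq nd E.
  exists <[y]>^!; first by apply/hyperplaneP; exists y.
  by split=> //; case: H => W pW [_ Wy HW]; exists W.
have db z : delta z b = 0 by rewrite /delta lb mulr1 addff.
pose g := q + (x + b).
have lg : lam g = 1 by rewrite !dotDl lq lx lb addff // addr0.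
have xg : delta x g = delta x q by rewrite !deltaDr deltaxx db !addr0.
exists <[g]>^!; first by apply/hyperplaneP; exists g.
split; apply: delta_equidistant; rewrite // ?xg //.
  by rewrite !deltaDr deltaxx db add0r addr0 deltaC.
by rewrite !deltaDl d0 (deltaC b) db add0r addr0 -E.
Qed.

(** * Definability of the inclusion relations *)

(** Inclusion between elements of the same kind is equality, by dimension. *)
Lemma def_sub X (x y : X) : definable M (fun v => (v x <= v y)%VS : Prop).
Proof.
apply: (@def_iff _ _ _ _ _ (fun v => v x = v y \/
  [/\ points M (v x), lines M (v y) & (v x <= v y)%VS])).
  move=> v Mv; split=> [sxy | [-> // | []//]].
  have [px | lx] := Mv x; have [py | ly] := Mv y; last 1 first.
  - by left; apply/eqP; rewrite eqEdim sxy (proj1 lx) (proj1 ly) /=.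
  - by left; apply/eqP; rewrite eqEdim sxy (proj1 px) (proj1 py) /=.
  - by right.
  by have := dimvS sxy; rewrite (proj1 lx) (proj1 py) ltnn.
by apply: def_or; [apply: def_eq | apply: def_inc].
Qed.

(** Atomic relations come first: they are conjunctions in disguise, which the
    rules for connectives would otherwise unfold. *)
Ltac fo leaf := repeat first
  [ leaf
  | apply: def_point | apply: def_line | apply: def_sub | apply: def_eq
  | apply: def_false
  | apply: def_ex_line; cbv beta | apply: def_ex_point; cbv beta
  | apply: def_all_line; cbv beta
  | apply: def_and3 | apply: def_equiv | apply: def_and | apply: def_or
  | apply: def_not | apply: def_imp ].

Lemma def_coll X (x y : X) : definable M (fun v => coll (v x) (v y)).
Proof. by fo fail. Qed.

Lemma def_equidistant X (x y z : X) :
  definable M (fun v => equidistant (v x) (v y) (v z)).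
Proof. by fo ltac:(apply: def_coll). Qed.

Lemma def_nonisolated X (x : X) : definable M (fun v => nonisolated (v x)).
Proof. by fo fail. Qed.

Lemma def_point_code X (x y : X) :
  definable M (fun v => point_code (v x) (v y)).
Proof.
case: pole_norm => lb.
  apply: (@def_iff _ _ _ _ _ (fun v => lines M (v x) /\ lines M (v y))).
    by move=> v _; apply: point_code_pole0.
  by fo fail.
apply: (@def_iff _ _ _ _ _ (fun v =>
  [/\ lines M (v x), lines M (v y) & coll (v x) (v y)])).
  by move=> v _; apply: point_code_pole1.
by fo ltac:(apply: def_coll).
Qed.

Definition point_on X Q Y := [/\ point_code X Q, lines M Y & (dec X Q <= Y)%VS].

Lemma def_point_on X (x q y : X) :
  definable M (fun v => point_on (v x) (v q) (v y)).
Proof.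
case: pole_norm => lb.
  apply: (@def_iff _ _ _ _ _ (fun v =>
    [/\ point_code (v x) (v q), lines M (v y) & ~ coll (v x) (v y)])).
    by move=> v _; split=> -[cX lY] H; split=> //; apply/(dec_sub_pole0 lb cX lY).
  by fo ltac:(first [apply: def_point_code | apply: def_coll]).
apply: (@def_iff _ _ _ _ _ (fun v => [/\ point_code (v x) (v q), lines M (v y) &
    exists2 G, lines M G &
      equidistant (v x) (v q) G /\ equidistant (v x) G (v y)])).
  by move=> v _; split=> -[cX lY] H; split=> //; apply/(dec_sub_pole1 lb cX lY).
by fo ltac:(first [apply: def_point_code | apply: def_equidistant]).
Qed.

Lemma def_point_eq X (x q x' q' : X) : definable M (fun v =>
  [/\ point_code (v x) (v q), point_code (v x') (v q') &
      dec (v x) (v q) = dec (v x') (v q')]).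
Proof.
apply: (@def_iff _ _ _ _ _ (fun v =>
  [/\ point_code (v x) (v q), point_code (v x') (v q') & forall Y,
      lines M Y -> point_on (v x) (v q) Y <-> point_on (v x') (v q') Y])).
  move=> v _; split=> -[cX cX' H]; split=> //.
    by move=> Y lY; split=> -[_ _]; [rewrite H | rewrite -H].
  have pX := point_code_point cX.
  have pX' := point_code_point cX'.
  apply: (proj2 (B1_point_eq pX pX')) => Y lY; have [H1 H2] := H Y lY.
  by split=> sY; [case: H1 | case: H2].
by fo ltac:(first [apply: def_point_code | apply: def_point_on]).
Qed.

Lemma def_line_code X (x y : X) :
  definable M (fun v => line_code (v x) (v y)).
Proof.
by fo ltac:(first [apply: def_nonisolated | apply: def_point_code]).
Qed.

Lemma def_incidence X (x q w q' : X) : definable M (fun v =>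
  [/\ point_code (v x) (v q), line_code (v w) (v q') &
      (dec (v x) (v q) <= dec (v w) (v q'))%VS]).
Proof.
apply: (@def_iff _ _ _ _ _ (fun v =>
  [/\ point_code (v x) (v q), line_code (v w) (v q') &
   exists2 Y, lines M Y & (v w <= Y)%VS /\
   [/\ point_code (v x) (v q), point_code Y (v q') &
       dec (v x) (v q) = dec Y (v q')]])).
  move=> v _; split=> -[cX cW].
    move/(point_on_line cW (point_code_point cX)) => -[Y [lY WY] E].
    split=> //; exists Y => //; split=> //; split=> //.
    by case: cW => _ _; apply.
  case=> Y lY [WY [_ _ E]]; split=> //.
  apply/(point_on_line cW); last by exists Y.
  exact: (point_code_point cX).
by fo ltac:(first
  [apply: def_point_code | apply: def_line_code | apply: def_point_eq]).
Qed.

Lemma def_line_eq X (w q w' q' : X) : definable M (fun v =>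
  [/\ line_code (v w) (v q), line_code (v w') (v q') &
      dec (v w) (v q) = dec (v w') (v q')]).
Proof.
apply: (@def_iff _ _ _ _ _ (fun v =>
  [/\ line_code (v w) (v q), line_code (v w') (v q') &
   forall Y, lines M Y -> (v w <= Y)%VS ->
   [/\ point_code Y (v q), line_code (v w') (v q') &
       (dec Y (v q) <= dec (v w') (v q'))%VS]])).
  move=> v _; split=> -[cW cW' H]; split=> //.
    move=> Y lY WY; split=> //; first by case: cW => _ _; apply.
    by apply: (proj1 (line_code_sub _ cW)); rewrite // H.
  have [[dW _] _] := line_code_line cW.
  have [[dW' _] _] := line_code_line cW'.
  apply/eqP; rewrite eqEdim dW dW' leqnn andbT.
  by apply: (proj2 (line_code_sub _ cW)) => // Y lY WY; case: (H Y lY WY).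
by fo ltac:(first [apply: def_line_code | apply: def_incidence]).
Qed.

Lemma def_visible X (x : X) : definable M (fun v => visible (v x)).
Proof. by fo ltac:(apply: def_nonisolated). Qed.

Lemma def_point_sub X (x q u : X) : definable M (fun v =>
  [/\ point_code (v x) (v q), visible (v u) & (dec (v x) (v q) <= v u)%VS]).
Proof.
apply: (@def_iff _ _ _ _ _ (fun v => [/\ point_code (v x) (v q), visible (v u) &
  forall Y, lines M Y -> (v u <= Y)%VS -> point_on (v x) (v q) Y])).
  move=> v _; split=> -[cX vU H]; split=> //.
    by move=> Y lY UY; split=> //; apply: subv_trans UY.
  have [_ H2] := meet_of_lines (dec (v x) (v q))
     (affine_orthogonal_element vU).
  by apply: H2 => Y lY UY; case: (H Y lY UY).
by fo ltac:(first
  [apply: def_point_code | apply: def_visible | apply: def_point_on]).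
Qed.

Lemma def_sub_point X (x q u : X) : definable M (fun v =>
  point_code (v x) (v q) /\ (v u <= dec (v x) (v q))%VS).
Proof.
apply: (@def_iff _ _ _ _ _ (fun v => point_code (v x) (v q) /\
  forall Y, lines M Y -> point_on (v x) (v q) Y -> (v u <= Y)%VS)).
  move=> v _; split=> -[cX H]; split=> //.
    by move=> Y lY [_ _ XY]; apply: subv_trans XY.
  have [_ H2] := meet_of_lines (v u)
     (affine_orthogonal_point (point_code_point cX)).
  by apply: H2 => Y lY XY; apply: H.
by fo ltac:(first [apply: def_point_code | apply: def_point_on]).
Qed.

Lemma def_line_sub X (w q u : X) : definable M (fun v =>
  [/\ line_code (v w) (v q), visible (v u) & (dec (v w) (v q) <= v u)%VS]).
Proof.
apply: (@def_iff _ _ _ _ _ (fun v => [/\ line_code (v w) (v q), visible (v u) &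
  forall Y, lines M Y -> (v w <= Y)%VS ->
   [/\ point_code Y (v q), visible (v u) & (dec Y (v q) <= v u)%VS]])).
  move=> v _; split=> -[cW vU H]; split=> //.
    move=> Y lY WY; split=> //; first by case: cW => _ _; apply.
    exact: (proj1 (line_code_sub _ cW)).
  by apply: (proj2 (line_code_sub _ cW)) => // Y lY WY; case: (H Y lY WY).
by fo ltac:(first
  [apply: def_line_code | apply: def_visible | apply: def_point_sub]).
Qed.

(** For n = 3 the secunda are points, and the pole is isolated because H contains
    no regular point. *)
Lemma nonisolated_point_B1 U : \dim {:V} = 3%N -> nonisolated U ->
  points (structB1 xi) U.
Proof.
move=> d3 nU; have [[dU rU] _] := nU.
move: dU rU; rewrite d3 => dU rU.
have /regular_pointP[z lz E] : regular_subspaces xi 1 U by [].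
apply/B1_pointP; exists z; split=> // zb.
have [x Ux lx] := affine_orthogonal_element (or_intror nU).
by move: Ux; rewrite E zb mem_orthov1 lx oner_eq0.
Qed.

Lemma dim_line_code W Q : line_code W Q -> \dim (dec W Q) = 2%N.
Proof. by move/line_code_line => -[[]]. Qed.

(** An element of the Grassmannian has dimension n - 2 or n - 1, so it can only
    be contained in a line of B_1 by being equal to it, with n = 3 or n = 4, or
    by being one of its points, with n = 3. *)
Lemma def_sub_line X (w q u : X) : definable M (fun v =>
  [/\ line_code (v w) (v q), visible (v u) & (v u <= dec (v w) (v q))%VS]).
Proof.
pose sup (v : X -> {vspace V}) :=
  [/\ line_code (v w) (v q), visible (v u) & (dec (v w) (v q) <= v u)%VS].
have dsup : definable M sup by apply: def_line_sub.
have equal_dim v : sup v -> \dim (v u) = 2%N -> (v u <= dec (v w) (v q))%VS.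
  case=> cW _ LU dU; suff <- : dec (v w) (v q) = v u by [].
  by apply/eqP; rewrite eqEdim LU dU dim_line_code.
have sup_of v : line_code (v w) (v q) -> visible (v u) ->
    (v u <= dec (v w) (v q))%VS -> \dim (v u) = 2%N -> sup v.
  move=> cW vU UL dU; split=> //; suff -> : v u = dec (v w) (v q) by [].
  by apply/eqP; rewrite eqEdim UL dU dim_line_code.
have [d3 | n3] := eqVneq (\dim {:V}) 3%N.
  apply: (@def_iff _ _ _ _ _ (fun v => [/\ line_code (v w) (v q), visible (v u) &
    (lines M (v u) /\ sup v) \/ exists2 Y, lines M Y & exists2 Q, lines M Q &
      (point_code Y Q /\ (v u <= dec Y Q)%VS) /\
      [/\ point_code Y Q, line_code (v w) (v q) &
          (dec Y Q <= dec (v w) (v q))%VS]])).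
    move=> v _; split=> -[cW vU].
      move=> UL; split=> //; case: vU => [lU | nU].
        by left; split=> //; apply: sup_of => //; [left | rewrite (proj1 lU) d3].
      have [Y [Q [cY E]]] := point_code_onto (nonisolated_point_B1 d3 nU).
      have [lY lQ _] := cY.
      by right; exists Y => //; exists Q => //; rewrite E.
    case=> [[lU sU] | [Y _ [Q _ [[_ UY] [_ _ YL]]]]]; split=> //.
      by apply: equal_dim => //; rewrite (proj1 lU) d3.
    exact: subv_trans YL.
  by fo ltac:(first [apply: def_line_code | apply: def_visible | exact: dsup
    | apply: def_sub_point | apply: def_incidence]).
have [d4 | n4] := eqVneq (\dim {:V}) 4%N.
  apply: (@def_iff _ _ _ _ _ (fun v => points M (v u) /\ sup v)).
    move=> v _; split=> [[cW vU UL] | [pU sU]].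
      have pU : points M (v u).
        case: vU => [[dU _] | [] //]; have := dimvS UL.
        by rewrite dU d4 dim_line_code.
      by split=> //; apply: sup_of; rewrite // (proj1 pU) d4.
    have [cW vU _] := sU; split=> //.
    by apply: equal_dim; rewrite // (proj1 pU) d4.
  by fo ltac:(exact: dsup).
apply: (@def_iff _ _ _ _ _ (fun _ => False)); last exact: def_false.
move=> v _; split=> // -[cW vU /dimvS]; rewrite dim_line_code //.
by case: vU => [[dU _] | [[dU _] _]]; rewrite dU; lia.
Qed.

Lemma B1_definable : definable_in (structB1 xi) M.
Proof.
pose i0 : 'I_2 := ord0; pose i1 : 'I_2 := ord_max.
have elem2 A B : lines M B -> element M A ->
    forall i, element M (tnth [tuple A; B] i).
  move=> lB eA i; rewrite (tnth_nth A); case: i => -[|[|//]] /= _.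
    exact: eA.
  by right.
have [pdom pdomP] := def_point_code i0 i1.
have [ldom ldomP] := def_line_code i0 i1.
have [peq peqP] := def_point_eq (inl i0) (inl i1) (inr i0 : 'I_2 + 'I_2) (inr i1).
have [leq leqP] := def_line_eq (inl i0) (inl i1) (inr i0 : 'I_2 + 'I_2) (inr i1).
have pcode a : codes M pdom a -> point_code (tnth a i0) (tnth a i1).
  by case=> Ma /pdomP; apply.
have lcode a : codes M ldom a -> line_code (tnth a i0) (tnth a i1).
  by case=> Ma /ldomP; apply.
pose dec2 (a : 2.-tuple {vspace V}) := dec (tnth a i0) (tnth a i1).
have join a c : (forall i, element M (tnth a i)) ->
    (forall i, element M (tnth c i)) ->
    forall s : 'I_2 + 'I_2, element M (sjoin (tnth a) (tnth c) s).
  by move=> ? ? [].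
have pin a : codes M pdom a -> points (structB1 xi) (dec2 a).
  by move/pcode/point_code_point.
have lin a : codes M ldom a -> lines (structB1 xi) (dec2 a).
  by move/lcode/line_code_line.
have ponto U : points (structB1 xi) U -> exists2 a, codes M pdom a & dec2 a = U.
  case/point_code_onto=> X [Q [cX <-]]; have [lX lQ _] := cX.
  have e2 : forall i, element M (tnth [tuple X; Q] i) by apply: elem2 => //; right.
  by exists [tuple X; Q] => //; split=> //; apply/pdomP.
have lonto U : lines (structB1 xi) U -> exists2 a, codes M ldom a & dec2 a = U.
  case/line_code_onto=> W [Q [cW <-]]; have [[pW _] lQ _] := cW.
  have e2 : forall i, element M (tnth [tuple W; Q] i) by apply: elem2 => //; left.
  by exists [tuple W; Q] => //; split=> //; apply/ldomP.
have peq2 a c : codes M pdom a -> codes M pdom c ->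
    sat M peq (sjoin (tnth a) (tnth c)) <-> dec2 a = dec2 c.
  move=> ca cc; rewrite peqP /=; last by apply: join; [case: ca | case: cc].
  by split=> [[] // | E]; split=> //; apply: pcode.
have leqv2 a c : codes M ldom a -> codes M ldom c ->
    sat M leq (sjoin (tnth a) (tnth c)) <-> dec2 a = dec2 c.
  move=> ca cc; rewrite leqP /=; last by apply: join; [case: ca | case: cc].
  by split=> [[] // | E]; split=> //; apply: lcode.
have opt a U : (forall i, element M (tnth a i)) -> element M U ->
    forall s : option 'I_2, element M (scons U (tnth a) s) by move=> ? ? [].
exists (Coding pin ponto peq2), (Coding lin lonto leqv2); split => /=.
- have [phi phiP] :=
    def_incidence (inl i0) (inl i1) (inr i0 : 'I_2 + 'I_2) (inr i1).
  exists phi => a c ca cc; rewrite phiP /=; last first.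
    by apply: join; [case: ca | case: cc].
  by split=> [[] // | E]; split=> //; [apply: pcode | apply: lcode].
- split=> /=.
    have [phi phiP] := def_point_sub (Some i0) (Some i1) None.
    exists phi => a U ca MU /(element_visible MU) vU.
    rewrite phiP /=; last by apply: opt => //; case: ca.
    by split=> [[] // | E]; split=> //; apply: pcode.
  have [phi phiP] := def_sub_point (Some i0) (Some i1) None.
  exists phi => a U ca MU /(element_visible MU) vU.
  rewrite phiP /=; last by apply: opt => //; case: ca.
  by split=> [[] // | E]; split=> //; apply: pcode.
split=> /=.
  have [phi phiP] := def_line_sub (Some i0) (Some i1) None.
  exists phi => a U ca MU /(element_visible MU) vU.
  rewrite phiP /=; last by apply: opt => //; case: ca.
  by split=> [[] // | E]; split=> //; apply: lcode.
have [phi phiP] := def_sub_line (Some i0) (Some i1) None.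
exists phi => a U ca MU /(element_visible MU) vU.
rewrite phiP /=; last by apply: opt => //; case: ca.
by split=> [[] // | E]; split=> //; apply: lcode.
Qed.

End Geometry.

Theorem theorem4p2 (F : fieldType) (V : vectType F) (n : nat)
    (xi : {symmetric V})
    (hchar : 2%N \in [pchar F]) (hperf : perfect_field F)
    (hdim : \dim {:V} = n) (hn : (3 <= n)%N)
    (hlines : lines_have_6_points V)
    (hnondeg : nondegenerate xi) (hnalt : ~ alternating xi) :
  definable_in (structB1 xi) (structG xi (n - 2)).
Proof.
have [b hb] := exists_pole_vector hnondeg hchar hperf; subst n.
exact: B1_definable.
Qed.
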